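(* Let $C=\mathrm{Av}(B)$ be an infinite, finitely based (that is, $B$ is finite) avoidance set of a poset $(X,\leq)$ of valid structures under the consecutive order, where $X$ is the set of all structures of some valid type. Let $b$ be the maximum length of an element of $B$ ($b=1$ if $B=\varnothing$) and let $\Gamma_C$ be the $b$-dimensional factor graph of $C$. Then $C$ is atomic if and only if: (1) $\Gamma_C$ is strongly connected or a bicycle with no ambiguous paths; and (2) for each $\sigma\in C$ with $|\sigma|\in[1,b-1]$ there is $\rho\in C$ with $|\rho|=b$ such that $\sigma\leq\rho$.
   Context: Conventions: $\mathbb{N}=\{1,2,3,\dots\}$ and $[m,n]=\{m,m+1,\dots,n\}$. Structures. A structure is a pair $(X,R)$ with $X$ a finite subset of $\mathbb{N}$ and $R$ a sequence of relations on $X$, the first of which is the linear order on $X$ inherited from $\mathbb{N}$. The sequence of arities of the relations in $R$ is the signature. Structures are of the same type if they have the same signature and, perhaps, satisfy certain additional conditions. Two structures of the same type are isomorphic ($\cong$) if relabelling the points of each in increasing order by $1,2,\dots$ gives exactly the same structure; isomorphic structures are considered equal, so every structure may be taken to have underlying set $[1,n]$ for some $n\in\mathbb{N}$. The length of $(X,R)$ is $|(X,R)|=|X|$. For $Y\subseteq X$, $\sigma\upharpoonright_Y$ is the restriction of $\sigma$ to the points in $Y$. Consecutive order: for $\sigma,\rho$ of the same type, $\sigma\leq\rho$ iff $\sigma\cong\rho\upharpoonright_{[k,k+|\sigma|-1]}$ for some $k\ge 1$ with $k+|\sigma|-1\le|\rho|$. Valid types. Let $\sigma,\rho$ be structures of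 the same type with $|\sigma|=p$, $|\rho|=q$. They overlap (on $x$ points) if $\sigma\upharpoonright_{[p-x+1,p]}\cong\rho\upharpoonright_{[1,x]}$ for some $x\geq 1$. A structure $\theta$ of the same type with $|\theta|=p+q-x$ combines them if $\theta\upharpoonright_{[1,p]}\cong\sigma$ and $\theta\upharpoonright_{[p-x+1,p+q-x]}\cong\rho$. A type is valid if for any two overlapping structures of this type there is a structure of the same type which combines them. Avoidance sets: $\mathrm{Av}(B)=\{x\in X: \beta\nleq x \text{ for all } \beta\in B\}$. A downward closed subset $C$ of a poset is atomic if it is not the union of two downward closed proper subsets of $C$; equivalently (joint embedding property) for all $x,y\in C$ there is $z\in C$ with $x,y\leq z$. Factor graph: $\Gamma_C$ is the digraph whose vertices are the structures in $C$ of length $b$, with an edge $u\to v$ iff $u\upharpoonright_{[2,b]}\cong v\upharpoonright_{[1,b-1]}$ (loops allowed; for $b=1$ both are restrictions to the empty set). A structure $\sigma\in C$ of length $n\ge b$ has the associated path $\Pi(\sigma)=\sigma\upharpoonright_{[1,b]}\to\sigma\upharpoonright_{[2,b+1]}\to\dots\to\sigma\upharpoonright_{[n-b+1,n]}$ in $\Gamma_C$. For a path $\pi$ in $\Gamma_C$, $\Sigma(\pi)=\{\sigma\in C:|\sigma|\ge b,\ \Pi(\sigma)=\pi\}$, and $\pi$ is ambiguous if $|\Sigma(\pi)|>1$. Digraph notions. A path is a sequence $v_1\to\dots\to v_n$ of vertices joined by edges, of length $n-1$; it is simple if its vertices are distinct. A cycle is a path of length $\ge1$ with $v_1=v_n$;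 it is simple if its only repeated vertex is the start/end vertex. A digraph is strongly connected if for any two vertices $u,v$ there is a path from $u$ to $v$. A bicycle consists of two vertex-disjoint simple cycles (the first, initial cycle and the second, terminal cycle) connected by a simple path whose internal vertices are disjoint from both cycles; either or both cycles may be absent, but if neither is absent the connecting path has length at least one.
   Formalization: For b=1 only, it is assumed that any two structures of the type overlapping on the empty set (x=0) are combined by one of the type; otherwise the claim fails (constant words on two letters, B empty). Types are taken to be closed under restriction to nonempty intervals. *)

(* Defs.v *)
From HB Require Import structures.
From mathcomp Require Import all_boot finmap.
From mathcomp Require Import boolp classical_sets functions cardinality.

Set Implicit Arguments.
Unset Strict Implicit.
Unset Printing Implicit Defensive.

Local Open Scope fset_scope.
Local Open Scope classical_set_scope.
Local Open Scope nat_scope.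

(** * Structures

    Structures are taken up to isomorphism: a structure of length n lives on
    'I_n, the ordinal x standing for the point x + 1 of [1,n].  The compulsory
    first relation, the linear order, is the order of 'I_n and is not stored;
    [sig] lists the arities of the other relations.  With this normal form
    isomorphism is Leibniz equality. *)

Definition relations (sig : seq nat) (n : nat) :=
  {dffun forall k : 'I_(size sig), {set (nth 0 sig k).-tuple 'I_n}}.

Definition structure (sig : seq nat) := {n : nat & relations sig n}.

HB.instance Definition _ (sig : seq nat) :=
  Choice.copy (structure sig) {n : nat & relations sig n}.

Section Structures.
Variable sig : seq nat.
Implicit Types (s t u : structure sig) (X C D : set (structure sig)).

Definition len s : nat := tag s.

(* [s] is a list of 0-based points; lists of the wrong size or with an entry
   beyond [len st] are not in the relation. *)
Definition holds (st : structure sig) (k : 'I_(size sig)) (s : seq nat) : bool :=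
  [exists t in (tagged st k : {set _}), map val (t : seq _) == s].

(* The restriction to the interval [i,j] (bounds in the 1-based numbering),
   relabelled in increasing order: the 0-based point x of the restriction is
   the 0-based point i - 1 + x of [s].  Meaningful for 1 <= i and j <= len s;
   the length is j + 1 - i, in particular 0 for the empty interval [i,i-1]. *)
Definition restr s (i j : nat) : structure sig :=
  Tagged (relations sig)
    (finfun (fun k : 'I_(size sig) =>
       [set t : (nth 0 sig k).-tuple 'I_(j.+1 - i) |
          holds s k [seq i.-1 + val x | x <- t]]%SET)
     : relations sig (j.+1 - i)).

Definition cle s t : Prop :=
  exists k : nat, [/\ 1 <= k, k + len s - 1 <= len t
                    & s = restr t k (k + len s - 1)].

(** * Types of structures *)

(* The structures of a type: those over [sig] that satisfy some further
   conditions.  Point sets are nonempty, and the restrictions of a structure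
   of the type to nonempty intervals are again of the type. *)
Definition structure_type X : Prop :=
  (forall s, X s -> 1 <= len s) /\
  (forall s i j, X s -> 1 <= i -> i <= j -> j <= len s -> X (restr s i j)).

Definition overlap (x : nat) s t : Prop :=
  [/\ x <= len s, x <= len t
    & restr s (len s - x + 1) (len s) = restr t 1 x].

Definition combines (x : nat) s t u : Prop :=
  [/\ len u = len s + len t - x,
      restr u 1 (len s) = s
    & restr u (len s - x + 1) (len s + len t - x) = t].

(* For x = 0 the overlap is the empty interval, and combining is juxtaposing.  *)
Definition combinable_on X (x : nat) : Prop :=
  forall s t, X s -> X t -> overlap x s t ->
    exists u, X u /\ combines x s t u.

Definition valid X : Prop := forall x : nat, 1 <= x -> combinable_on X x.

(** * Downward closed sets *)

Definition avoid X (B : {fset structure sig}) : set (structure sig) :=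
  [set s | X s /\ forall t, t \in B -> ~ cle t s].

Definition max_len (B : {fset structure sig}) : nat :=
  if B == fset0 then 1 else \max_(t <- B) len t.

Definition down_closed X D : Prop :=
  D `<=` X /\ forall s t, D t -> X s -> cle s t -> D s.

Definition atomic X C : Prop :=
  ~ exists D1 D2, [/\ down_closed X D1, down_closed X D2,
                      D1 `<` C, D2 `<` C & C = D1 `|` D2].

End Structures.

(** * Digraphs *)

Record digraph (V : eqType) := Digraph { vert : set V; edge : rel V }.

Section Digraphs.
Variables (V : eqType) (G : digraph V).
Implicit Types (p c : seq V).

Definition is_path p : bool :=
  if p is x :: q then all (fun v => v \in vert G) p && path (edge G) x q
  else false.

Definition strongly_connected : Prop :=
  forall u v, vert G u -> vert G v ->
    exists q : seq V, is_path (u :: q) /\ last u q = v.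

(* A simple cycle v1 -> ... -> vn -> v1 is given by its distinct vertices
   [:: v1; ...; vn]. *)
Definition simple_cycle c : bool :=
  if c is x :: q then is_path (x :: rcons q x) && uniq c else false.

Definition path_edges p : seq (V * V) := zip p (behead p).
Definition cycle_edges c : seq (V * V) := zip c (rot 1 c).

(* c1 and c2 are the initial and terminal cycles, [::] if absent; x :: q is the
   connecting path, with internal vertices [behead (belast x q)]. *)
Definition bicycle : Prop :=
  exists (c1 c2 : seq V) (x : V) (q : seq V),
    [/\ [/\ c1 != [::] -> simple_cycle c1 /\ x \in c1,
            c2 != [::] -> simple_cycle c2 /\ last x q \in c2
          & forall v, v \in c1 -> v \notin c2],
        [/\ is_path (x :: q), uniq (x :: q),
            forall v, v \in behead (belast x q) -> v \notin c1 ++ c2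
          & c1 != [::] -> c2 != [::] -> 1 <= size q],
        forall v, vert G v <-> v \in (x :: q) ++ c1 ++ c2
      & forall u v, edge G u v <->
          (u, v) \in path_edges (x :: q) ++ cycle_edges c1 ++ cycle_edges c2].

End Digraphs.

(** * The factor graph *)

Section FactorGraph.
Variables (sig : seq nat) (C : set (structure sig)) (b : nat).

Definition fg_vert : set (structure sig) := [set u | C u /\ len u = b].

Definition fg_edge : rel (structure sig) := fun u v =>
  [&& u \in fg_vert, v \in fg_vert & restr u 2 b == restr v 1 (b - 1)].

Definition factor_graph : digraph (structure sig) := Digraph fg_vert fg_edge.

Definition assoc_path (s : structure sig) : seq (structure sig) :=
  [seq restr s i (i + b - 1) | i <- iota 1 (len s - b + 1)].

Definition path_structures (p : seq (structure sig)) : set (structure sig) :=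
  [set s | [/\ C s, b <= len s & assoc_path s = p]].

Definition ambiguous (p : seq (structure sig)) : Prop :=
  exists s t, [/\ path_structures p s, path_structures p t & s <> t].

End FactorGraph.

(* Main.v *)
Require Import Defs.
From mathcomp Require Import all_boot finmap zify.
From mathcomp Require Import boolp classical_sets functions cardinality.

(** Atomicity of [C] is the joint embedding property ([atomicP]), and the
    proof translates it into a property of walks in the factor graph.

    Two members of [C] that overlap on at least [b - 1] points can be combined
    inside [C] ([combine_in_C]): a base element has length at most [b], so an
    occurrence of it in the combined structure would already lie in one of the
    two parts.  Hence every walk of the factor graph is the associated path of
    some member of [C], and a member of [C] extends along every walk that
    prolongs its associated path ([extend]).  So joint embedding of structures
    yields joint embedding of walks ([joint_embedding_walks]); conversely, a
    structure whose path contains that of [s] has a factor with the path of [s],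
    and this factor is [s] itself if the path is not ambiguous.  Condition (2) reduces joint embedding to structures
    of length at least [b]; it is necessary since [C], being infinite, has
    members of every large enough length.  If the graph is strongly connected,
    joint embedding is immediate: prolong one structure along a walk that ends
    in the first window of the other, and overlap the two on that window.

    The rest is about digraphs that are not strongly connected, and its hinge
    is the notion of [one_way_cut]: the vertices split into [S] and its
    complement, a single edge [a -> a'] leads from [S] to the complement and
    none leads back; within [S] walks are determined by their length and
    their last vertex, and all of them can be prolonged to [a], while dually,
    outside [S], walks are determined by their length and their first vertex,
    and all vertices are reached from [a'].
    - Joint embedding of walks gives a one-way cut ([embedding_cut]): take for
      [S] the vertices that reach some fixed [u0].  A walk leaves [S] at most
      once, so two walks through crossing edges can lie in a common walk only
      if their crossing edges coincide and the walks agree around them.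
    - A one-way cut gives joint embedding of walks ([cut_embedding]): prolong
      both walks until they contain [a -> a'], align them there, and keep the
      longer of the two parts on either side.
    - In a finite digraph a one-way cut gives a bicycle ([cut_bicycle]): the
      only walk that starts at [a'] either stops or runs into itself
      ([rho_shape]), and so does the only walk that ends at [a], read backwards.
    - A bicycle that is not strongly connected has a one-way cut
      ([bicycle_cut]), at the first edge of its connecting path.
    Ambiguity is excluded by the same alignment ([cut_unambiguous]): two
    structures with the same path extend to two structures with the same path
    through [a -> a'], which occurs at only one place in a walk, so that
    a structure containing both contains them at the same place. *)

Set Implicit Arguments.
Unset Strict Implicit.
Unset Printing Implicit Defensive.

Local Open Scope fset_scope.
Local Open Scope classical_set_scope.
Local Open Scope nat_scope.

(** * Factors of structures *)

Section Factors.
Variable sig : seq nat.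
Implicit Types s t u : structure sig.

Definition factor s (o n : nat) : structure sig := restr s o.+1 (o + n).

Lemma len_restr s i j : len (restr s i j) = j.+1 - i.
Proof. by []. Qed.

Lemma len_factor s o n : len (factor s o n) = n.
Proof. by rewrite /factor len_restr; lia. Qed.

Lemma holds_dom s k l :
  holds s k l -> size l = nth 0 sig k /\ all (fun x => x < len s) l.
Proof.
case/existsP=> t /andP[_ /eqP <-]; rewrite size_map size_tuple; split=> //.
by apply/allP=> x /mapP[y _ ->]; apply: ltn_ord.
Qed.

Lemma holds_val s (k : 'I_(size sig)) (t : (nth 0 sig k).-tuple 'I_(len s)) :
  holds s k (map val t) = (t \in tagged s k).
Proof.
apply/existsP/idP=> [[t' /andP[t's /eqP e]]|ts].
  suff <-: t' = t by [].
  by apply: val_inj; apply: (inj_map val_inj).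
by exists t; rewrite ts eqxx.
Qed.

(** Relations are sets of tuples over the dependent type ['I_(len s)]; testing
    them on lists of numbers makes structures of provably equal lengths
    comparable. *)
Lemma structure_ext s t : len s = len t ->
  (forall k l, holds s k l = holds t k l) -> s = t.
Proof.
case: s t => [n r] [m r'] /= e; rewrite /len /= in e.
subst m => H; congr (existT _ _ _); apply/ffunP=> k; apply/setP=> x.
by have := H k (map val x); rewrite !holds_val.
Qed.

Lemma lift_ords n l : all (fun x => x < n) l ->
  exists l' : seq 'I_n, map val l' = l.
Proof.
elim: l => [|x l IH] /=; first by exists [::].
by case/andP=> xn /IH[l' <-]; exists (Ordinal xn :: l').
Qed.

Lemma holds_restr s i j k l : holds (restr s i j) k l =
  [&& size l == nth 0 sig k, all (fun x => x < j.+1 - i) l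
    & holds s k [seq i.-1 + x | x <- l]].
Proof.
apply/idP/idP => [H|/and3P[/eqP sl al H]].
  have [sl al] := holds_dom H; rewrite sl eqxx al /=.
  case/existsP: H => t /andP[+ /eqP <-].
  by rewrite /restr /= ffunE inE -map_comp.
have [l' el] := lift_ords al.
have sl' : size l' == nth 0 sig k by rewrite -sl -el size_map.
rewrite -el (holds_val (s := restr s i j) (Tuple sl')) /= ffunE inE /=.
by move: H; rewrite -el -map_comp.
Qed.

Lemma holds_factor s o n k l : holds (factor s o n) k l =
  [&& size l == nth 0 sig k, all (fun x => x < n) l
    & holds s k [seq o + x | x <- l]].
Proof. by rewrite holds_restr subSS addKn. Qed.

Lemma factor_full s : factor s 0 (len s) = s.
Proof.
apply: structure_ext; first by rewrite len_factor.
move=> k l; rewrite holds_factor.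
rewrite (eq_map (g := id)) // map_id.
apply/and3P/idP=> [[]//|H]; have [-> ->] := holds_dom H; by split.
Qed.

(** With an offset and a length in place of the two ends of an interval,
    restrictions compose by adding offsets, also when they are empty. *)
Lemma factor_factor s o n o' n' : o' + n' <= n ->
  factor (factor s o n) o' n' = factor s (o + o') n'.
Proof.
move=> le_n; apply: structure_ext; first by rewrite !len_factor.
move=> k l; rewrite !holds_factor size_map.
have -> : [seq o + i | i <- [seq o' + x | x <- l]] = [seq o + o' + x | x <- l].
  by rewrite -map_comp; apply: eq_map => x /=; rewrite addnA.
case: (size l == _) => //=.
have [al|] //= := boolP (all (fun x => x < n') l).
suff -> : all (fun x => x < n) [seq o' + x | x <- l] by [].
rewrite all_map; apply: sub_all al => x /=; lia.
Qed.

Lemma cleP s t :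
  cle s t <-> exists2 o, o + len s <= len t & s = factor t o (len s).
Proof.
split=> [[k [k1 le_t e]]|[o le_t e]].
  exists k.-1; first lia.
  by rewrite /factor prednK //; rewrite {1}e; congr restr; lia.
exists o.+1; split => //; first lia.
by rewrite {1}e /factor; congr restr; lia.
Qed.

Lemma factor_cle s t o :
  factor t o (len s) = s -> o + len s <= len t -> cle s t.
Proof. by move=> E le_t; apply/cleP; exists o. Qed.

Lemma cle_refl s : cle s s.
Proof. by apply/cleP; exists 0; rewrite ?factor_full. Qed.

Lemma cle_len s t : cle s t -> len s <= len t.
Proof. by case/cleP=> o; lia. Qed.

Lemma cle_factor s o n : o + n <= len s -> cle (factor s o n) s.
Proof. by move=> H; apply/cleP; exists o; rewrite len_factor. Qed.

Lemma cle_trans s t u : cle s t -> cle t u -> cle s u.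
Proof.
case/cleP=> o le_o es /cleP[o' le_o' et]; apply/cleP; exists (o' + o); first lia.
by rewrite {1}es et factor_factor.
Qed.

Definition structures_of_len n : seq (structure sig) :=
  [seq Tagged (relations sig) r | r : relations sig n].

Lemma structures_of_lenP s : s \in structures_of_len (len s).
Proof. by case: s => n r; apply/mapP; exists r; rewrite ?mem_enum. Qed.

(** There are finitely many structures of each length. *)
Lemma infinite_long (C : set (structure sig)) n :
  infinite_set C -> exists2 s, C s & n <= len s.
Proof.
move=> infC; apply: contrapT => H; apply: infC.
apply: (@sub_finite_set _ _
  [set` flatten [seq structures_of_len i | i <- iota 0 n]]); last first.
  exact: finite_seq.
move=> s Cs; apply/flatten_mapP; exists (len s); last exact: structures_of_lenP.
rewrite mem_iota /= add0n ltnNge; apply/negP=> le_n; apply: H; by exists s.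
Qed.

End Factors.

Section JointEmbedding.
Variables (sig : seq nat) (X C : set (structure sig)).

Definition joint_embedding : Prop :=
  forall s t, C s -> C t -> exists u, [/\ C u, cle s u & cle t u].

(** If [s] and [t] have no common extension in [C], then the members of [C]
    that avoid [s] and those that avoid [t] cover [C]. *)
Lemma atomicP : down_closed X C -> atomic X C <-> joint_embedding.
Proof.
move=> [CX dC]; split=> [atC s t Cs Ct|JE [D1 [D2 [[_ d1] [_ d2] p1 p2 eC]]]].
  apply: contrapT => noU; apply: atC.
  pose D v := [set z : structure sig | C z /\ ~ cle v z].
  have dD v : down_closed X (D v).
    split=> [z [Cz _]|z w [Cw nvw] Xz zw]; first exact: CX.
    split; first exact: dC zw.
    by move=> vz; apply: nvw; apply: cle_trans zw.
  have pD v : C v -> D v `<` C.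
    move=> Cv; split; first by move=> z [].
    by move=> /(_ v Cv) [_]; apply; apply: cle_refl.
  exists (D s), (D t); split; try by [apply: dD|apply: pD].
  apply/seteqP; split=> z; last by case=> [] [].
  move=> Cz; case: (pselect (cle s z)) => [sz|]; last by left.
  by right; split=> // tz; apply: noU; exists z.
case: p1 => _ /nonsubset [s [Cs ns]]; case: p2 => _ /nonsubset [t [Ct nt]].
have [u [Cu su tu]] := JE s t Cs Ct.
move: (Cu); rewrite eC => -[] Du;
  [apply: ns; apply: d1 Du _ su|apply: nt; apply: d2 Du _ tu];
  exact: CX.
Qed.
End JointEmbedding.

(** * Paths and cycles as lists of vertices *)

Section Edges.
Variable V : eqType.
Implicit Types (e : rel V) (p q c l r : seq V) (u v x y z : V).

Lemma path_edges_cons x y q :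
  path_edges [:: x, y & q] = (x, y) :: path_edges (y :: q).
Proof. by []. Qed.

(** The two lists share the vertex [x], which is why no edge is lost. *)
Lemma path_edges_cat l x r :
  path_edges (l ++ x :: r) = path_edges (rcons l x) ++ path_edges (x :: r).
Proof.
elim: l => [|y l IH] //; case: l IH => [|z l] //= IH.
by rewrite -[path_edges (y :: _)]/((y, z) :: path_edges (z :: _)) IH.
Qed.

Lemma cycle_edgesE x q : cycle_edges (x :: q) = path_edges (x :: rcons q x).
Proof.
rewrite /cycle_edges /path_edges rot1_cons /=.
by elim: q {1 3}x => [|z q IH] y //=; rewrite -IH.
Qed.

Lemma path_edgesP e x q u v :
  path e x q -> (u, v) \in path_edges (x :: q) -> e u v.
Proof.
elim: q x => [|y q IH] x //= /andP[exy pq].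
rewrite inE => /orP[/eqP[-> ->] //|]; exact: IH.
Qed.

Lemma mem_path_edges x q u v :
  (u, v) \in path_edges (x :: q) -> u \in belast x q /\ v \in q.
Proof.
elim: q x => [|y q IH] x //; rewrite path_edges_cons in_cons.
case/orP=> [/eqP[-> ->]|/IH[ub vq]]; rewrite [belast _ _]/= ?in_cons ?eqxx //.
by rewrite ub vq !orbT.
Qed.

Lemma path_edges_belast x q u :
  u \in belast x q -> exists v, (u, v) \in path_edges (x :: q).
Proof.
elim: q x => [|y q IH] x //=; rewrite inE => /orP[/eqP->|/IH[v Hv]].
  by exists y; rewrite inE eqxx.
by exists v; rewrite inE Hv orbT.
Qed.

Lemma path_edges_det x q u v w : uniq (x :: q) ->
  (u, v) \in path_edges (x :: q) -> (u, w) \in path_edges (x :: q) -> v = w.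
Proof.
elim: q x => [|y q IH] x //= /andP[xq Uq].
have nx t : (x, t) \notin path_edges (y :: q).
  by apply: contra xq => /mem_path_edges[/mem_belast].
rewrite !path_edges_cons !in_cons.
case/orP=> [/eqP[-> ->]|Hv] /orP[/eqP|Hw].
- by case.
- by case/negP: (nx w).
- by case=> E1 _; case/negP: (nx v); rewrite -E1.
- exact: IH Hv Hw.
Qed.

Lemma path_edges_rev p u v :
  ((u, v) \in path_edges (rev p)) = ((v, u) \in path_edges p).
Proof.
elim: p => [|x [|y p] IH] //.
rewrite !rev_cons -cats1 cat_rcons path_edges_cat mem_cat -rev_cons IH.
by rewrite path_edges_cons mem_seq1 in_cons orbC !xpair_eqE andbC.
Qed.

Lemma cycle_edgesP c u v : uniq c ->
  (u, v) \in cycle_edges c <-> u \in c /\ v = next c u.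
Proof.
case: c => [|x q] Uc; first by split=> // -[].
have edge_next t w : (t, w) \in cycle_edges (x :: q) -> w = next (x :: q) t.
  rewrite cycle_edgesE => H; apply/esym/eqP.
  exact: (path_edgesP (e := frel (next (x :: q))) (cycle_next Uc) H).
split=> [H|[uc ->]].
  split; last exact: edge_next.
  by rewrite cycle_edgesE in H; have [] := mem_path_edges H; rewrite belast_rcons.
have [v' H] : exists v', (u, v') \in cycle_edges (x :: q).
  by rewrite cycle_edgesE; apply: path_edges_belast; rewrite belast_rcons.
by rewrite -(edge_next _ _ H).
Qed.

Lemma cycle_edges_rev c u v : uniq c ->
  (u, v) \in cycle_edges (rev c) <-> (v, u) \in cycle_edges c.
Proof.
move=> Uc; rewrite !cycle_edgesP ?rev_uniq // mem_rev next_rev //.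
split=> -[H ->]; first by rewrite mem_prev next_prev.
by rewrite mem_next prev_next.
Qed.

Lemma path_closed e (D : pred V) x q :
  (forall u v, D u -> e u v -> D v) -> D x -> path e x q -> all D (x :: q).
Proof.
move=> closed; elim: q x => [|y q IH] x Dx /=; first by rewrite Dx.
by case/andP=> exy /(IH y (closed _ _ Dx exy)) /= ->; rewrite Dx.
Qed.

Definition reaches e u v : Prop := exists2 q, path e u q & last u q = v.

(** Walks with the same start never diverge where out-degrees are at most
    one. *)
Lemma det_path_prefix e (D : pred V) x q r :
  (forall u v, D u -> e u v -> D v) ->
  (forall u v w, D u -> e u v -> e u w -> v = w) ->
  D x -> path e x q -> path e x r ->
  exists t, r = q ++ t \/ q = r ++ t.
Proof.
move=> closed det; elim: q x r => [|y q IH] x [|z r] Dx //=;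
  try by [exists (z :: r); left|exists (y :: q); right|exists [::]; left].
case/andP=> exy pq /andP[exz pr]; have ezy := det _ _ _ Dx exz exy; subst z.
have [t [->|->]] := IH y r (closed _ _ Dx exy) pq pr; exists t; by [left|right].
Qed.

(** A simple path that cannot be prolonged: in a finite set of vertices,
    lengthening a simple path must come to an end. *)
Lemma exists_maximal_path e (s : seq V) y :
  y \in s -> (forall u v, e u v -> v \in s) ->
  exists q, [/\ path e y q, uniq (y :: q)
    & forall z, e (last y q) z -> z \in y :: q].
Proof.
move=> ys es.
suff H n q : path e y q -> uniq (y :: q) -> size s - size q < n ->
    exists q, [/\ path e y q, uniq (y :: q)
      & forall z, e (last y q) z -> z \in y :: q].
  exact: (H (size s - 0).+1 [::]).
elim: n q => // n IH q pq Uq lt_n.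
have [[z [ez nz]]|H] := pselect (exists z, e (last y q) z /\ z \notin y :: q);
    last first.
  exists q; split=> // z ez; apply: contrapT => /negP nz; apply: H; by exists z.
have pqz : path e y (rcons q z) by rewrite rcons_path pq.
have Uqz : uniq (y :: rcons q z) by rewrite -rcons_cons rcons_uniq nz.
apply: (IH _ pqz Uqz).
have : size (y :: rcons q z) <= size s.
  apply: uniq_leq_size Uqz _.
  by apply/allP; apply: (path_closed (D := mem s)) pqz => // u v _; apply: es.
by rewrite /= !size_rcons; lia.
Qed.

(** A vertex set with out-degrees at most one in which everything is reached
    from [y] has the shape of the letter rho: follow the successors from [y]
    as long as they are new.  If the last vertex has a successor [z], then [z]
    is already on the path, which is cut there into a tail [q] ending in [z]
    and a cycle [c] through [z]; otherwise there is no cycle and [c] is empty.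
    The set [D] is closed under successors, so the path exhausts it. *)
Lemma rho_shape e (D : pred V) (s : seq V) y :
  (forall v, D v -> v \in s) -> D y ->
  (forall u v, D u -> e u v -> D v) ->
  (forall u v w, D u -> e u v -> e u w -> v = w) ->
  (forall v, D v -> reaches e y v) ->
  exists q c,
    [/\ path e y q /\ uniq (y :: q),
        [/\ cycle e c, uniq c & c != [::] -> last y q \in c],
        forall v, v \in belast y q -> v \notin c,
        forall v, D v = (v \in (y :: q) ++ c)
      & forall u v, D u ->
          e u v = ((u, v) \in path_edges (y :: q) ++ cycle_edges c)].
Proof.
move=> Ds Dy closed det reach.
have Dpath q := @path_closed e D y q closed Dy.
have [q [pq Uq maxq]] : exists q, [/\ path e y q, uniq (y :: q)
    & forall z, e (last y q) z -> z \in y :: q].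
  have [|q [pq Uq maxq]] :=
    @exists_maximal_path (fun u v => D u && e u v) s y (Ds _ Dy).
  - by move=> u v /andP[/closed Du /Du/Ds].
  have pq' : path e y q by apply: sub_path pq => u v /andP[].
  exists q; split=> // z ez; apply: maxq; rewrite ez andbT.
  by apply: (allP (Dpath q pq')); apply: mem_last.
have all_y v : D v = (v \in y :: q).
  apply/idP/idP=> [/reach[r pr <-]|]; last exact: (allP (Dpath q pq)).
  have sub_q u w : u \in y :: q -> e u w -> w \in y :: q.
    rewrite {1}lastI mem_rcons inE => /orP[/eqP->|]; first exact: maxq.
    case/path_edges_belast=> w' H euw.
    have -> : w = w'.
      apply: det euw (path_edgesP pq H); apply: (allP (Dpath q pq)).
      by have [/mem_belast] := mem_path_edges H.
    by have [_] := mem_path_edges H; rewrite in_cons orbC => ->.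
  have: y \in y :: q by rewrite mem_head.
  elim: r {1 2 4}y pr => [|z r IH] x //= /andP[exz pr] xq.
  by apply: IH => //; apply: sub_q exz.
have edge_q u v : u \in belast y q -> 
    e u v = ((u, v) \in path_edges (y :: q)).
  move=> ub; apply/idP/idP=> [euv|]; last exact: path_edgesP.
  have [w H] := path_edges_belast ub.
  suff -> : v = w by [].
  apply: det euv (path_edgesP pq H); rewrite all_y.
  by rewrite lastI mem_rcons inE ub orbT.
have [[z ez]|noz] := pselect (exists z, e (last y q) z); last first.
  exists q, [::]; rewrite !cats0; split=> // u v.
  rewrite all_y {1}lastI mem_rcons inE => /orP[/eqP->|]; last exact: edge_q.
  transitivity false; first by apply/negP => H; apply: noz; exists v.
  apply/esym/negP => H; apply: noz; exists v; exact: path_edgesP H.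
have zq := maxq z ez.
(* [z] is on the path, so the path splits as [l], then [z], then [r]; the
   cycle is [z :: r] and the tail is [y :: q1], which is [rcons l z]. *)
have [l [r [e_q]]] : exists l r, y :: q = l ++ z :: r.
  by case/splitPr: zq => l r; exists l, r.
have [q1 e_q1] : exists q1, rcons l z = y :: q1.
  case: l e_q => [[-> _]|x l [-> _]]; first by exists [::].
  by exists (rcons l z).
have last_r : last z r = last y q.
  by have := congr1 (last y) e_q; rewrite last_cat.
have e_yq : y :: q = (y :: q1) ++ r by rewrite -e_q1 cat_rcons.
have last_q1 : last y q1 = z.
  by have := congr1 (last z) e_q1; rewrite last_rcons.
have [pq1 pr] : path e y q1 /\ path e z r.
  by move: pq; case: e_yq => ->; rewrite cat_path last_q1 => /andP[].
have Ul : uniq (l ++ z :: r) by rewrite -e_q.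
exists q1, (z :: r); split.
- by split=> //; move: Uq; rewrite e_yq cat_uniq => /andP[].
- split; first by rewrite /= rcons_path pr last_r.
    by move: Ul; rewrite cat_uniq => /and3P[].
  by rewrite last_q1 mem_head.
- have <- : l = belast y q1.
    by have := lastI y q1; rewrite last_q1 -e_q1 => /rcons_inj[].
  move=> v vl; move: Ul; rewrite cat_uniq => /and3P[_ /hasPn H _].
  by apply/negP=> /H; rewrite /= vl.
- move=> v; rewrite all_y e_yq !mem_cat [v \in z :: r]in_cons.
  have [->|//] := eqVneq v z; have -> // : z \in y :: q1.
  by rewrite -last_q1 mem_last.
- have E u v : ((u, v) \in path_edges (y :: q1) ++ cycle_edges (z :: r)) =
     ((u, v) \in path_edges (y :: q)) || ((u, v) == (last y q, z)).
    rewrite e_q path_edges_cat cycle_edgesE -e_q1 -last_r.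
    rewrite !mem_cat -orbA; congr orb.
    have -> : z :: rcons r z = belast z r ++ last z r :: [:: z].
      by rewrite -rcons_cons -cats1 lastI cat_rcons.
    by rewrite path_edges_cat -lastI mem_cat mem_seq1.
  move=> u v Du; rewrite E xpair_eqE.
  move: Du; rewrite all_y {1}lastI mem_rcons inE => /orP[/eqP->|ub].
    rewrite eqxx /=; apply/idP/orP=> [ev|[H|/eqP->//]].
      by right; apply/eqP; apply: det ev ez; rewrite all_y mem_last.
    exact: path_edgesP H.
  rewrite edge_q //; have -> : (u == last y q) = false; last by rewrite orbF.
  apply/negP=> /eqP eu; move: Uq; rewrite lastI rcons_uniq -eu ub //.
Qed.

End Edges.

(** * One-way cuts and joint embedding of walks *)

(** A [digraph] may have edges outside its vertex set; factor graphs do not. *)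
Definition spanning (V : eqType) (G : digraph V) : Prop :=
  forall u v, edge G u v -> vert G u /\ vert G v.

Definition walk_embedding (V : eqType) (G : digraph V) : Prop :=
  forall p q, is_path G p -> is_path G q ->
    exists r, [/\ is_path G r, infix p r & infix q r].

(** What a bicycle looks like from an edge of its connecting path: [S] is the
    part before the edge, and the last four fields say that [S] is a backward
    rho shape issued from [a], its complement a forward one issued from [a']. *)
Record one_way_cut (V : eqType) (G : digraph V) (S : pred V) (a a' : V) : Prop :=
  OneWayCut {
    cut_edge : edge G a a';
    cut_src : S a;
    cut_tgt : ~~ S a';
    cut_closed : forall u v, edge G u v -> S v -> S u;
    cut_unique : forall u v, edge G u v -> S u -> ~~ S v -> u = a /\ v = a';
    cut_indeg : forall u v w, edge G u w -> edge G v w -> S w -> u = v;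
    cut_outdeg : forall u v w, edge G w u -> edge G w v -> ~~ S w -> u = v;
    cut_to : forall v, vert G v -> S v -> reaches (edge G) v a;
    cut_from : forall v, vert G v -> ~~ S v -> reaches (edge G) a' v }.

Definition converse (V : eqType) (G : digraph V) : digraph V :=
  Digraph (vert G) (fun u v => edge G v u).

Section Cuts.
Variables (V : eqType) (G : digraph V).
Hypothesis G_span : spanning G.
Implicit Types (S : pred V) (p q c l r : seq V) (u v x y z a : V).
Notation e := (edge G).

Lemma is_path_cons x q : is_path G (x :: q) <-> vert G x /\ path e x q.
Proof.
rewrite /is_path; split=> [/andP[/= /andP[/set_mem vx _] ->]//|[vx pq]].
rewrite pq andbT.
apply: (path_closed (D := fun v => v \in vert G)) pq; last exact: mem_set.
by move=> u v _ /G_span[_ vv]; apply: mem_set.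
Qed.

Lemma is_path_sorted p : is_path G p -> sorted e p.
Proof. by case: p => // x q /is_path_cons[]. Qed.

Lemma is_path_through l u v r :
  is_path G (l ++ u :: v :: r) = sorted e (l ++ u :: v :: r).
Proof.
apply/idP/idP=> [/is_path_sorted//|].
by case: l => [|x [|y l]] s; apply/is_path_cons; split=> //;
  have /andP[/G_span[] //] := s.
Qed.

(** The notion is self-dual, so a fact about the part after the cut gives the
    corresponding fact about the part before it. *)
Lemma converse_cut S a a' :
  one_way_cut G S a a' -> one_way_cut (converse G) (predC S) a' a.
Proof.
case=> eaa Sa Sa' cl un ind outd to from.
have rev_walk x y : reaches e x y -> reaches (edge (converse G)) y x.
  case=> q pq <-; exists (rev (belast x q)); first by rewrite rev_path.
  by case: q {pq} => [|z q] //=; rewrite rev_cons last_rcons.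
split=> //=.
- by rewrite negbK.
- by move=> u v euv; apply: contra => /(cl _ _ euv).
- by move=> u v euv nSu /negbNE Sv; case: (un _ _ euv Sv nSu).
- by move=> u v w euw evw /negbNE; apply: ind.
- by move=> v vv Sv; apply: rev_walk; apply: from.
- by move=> v vv /negbNE Sv; apply: rev_walk; apply: to.
Qed.

Lemma sorted_before S l x :
  (forall u v, e u v -> S v -> S u) -> sorted e (rcons l x) -> S x -> all S l.
Proof.
move=> closed; rewrite -rev_sorted rev_rcons => H Sx.
have := path_closed (fun u v Su evu => closed v u evu Su) Sx H.
by rewrite /= all_rev => /andP[].
Qed.

(** Since a walk never returns to [S], its vertices in [S] form a prefix, and
    the position of the crossing edge can be read off from the walk alone. *)
Lemma crossing_find S l a a' r :
  (forall u v, e u v -> S v -> S u) ->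
  sorted e (l ++ a :: a' :: r) -> S a -> ~~ S a' ->
  find (predC S) (l ++ a :: a' :: r) = (size l).+1.
Proof.
move=> closed sl Sa Sa'; rewrite find_cat.
have -> : has (predC S) l = false.
  apply/negbTE; rewrite has_predC negbK.
  move: sl; rewrite -cat_rcons => /cat_sorted2[sl _].
  exact: sorted_before sl Sa.
by rewrite /= Sa /= Sa' addn1.
Qed.

Lemma crossing_align S l a a' r l1 b b' r1 :
  (forall u v, e u v -> S v -> S u) ->
  sorted e (l ++ a :: a' :: r) -> S a -> ~~ S a' -> S b -> ~~ S b' ->
  l ++ a :: a' :: r = l1 ++ b :: b' :: r1 ->
  [/\ l = l1, a = b, a' = b' & r = r1].
Proof.
move=> closed sl Sa Sa' Sb Sb' E.
have := crossing_find closed sl Sa Sa'.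
rewrite {1}E (crossing_find closed _ Sb Sb') -?E // => -[/esym sz].
by move/eqP: E; rewrite eqseq_cat // => /andP[/eqP-> /eqP[-> -> ->]].
Qed.

Lemma path_crosses S x q : path e x q -> S x -> ~~ S (last x q) ->
  exists l b b' r, [/\ x :: q = l ++ b :: b' :: r, e b b', S b & ~~ S b'].
Proof.
elim: q x => [|y q IH] x /=; first by move=> _ ->.
case/andP=> exy pq Sx nS; have [Sy|nSy] := boolP (S y).
  have [l [b [b' [r [-> ebb Sb Sb']]]]] := IH y pq Sy nS.
  by exists (x :: l), b, b', r.
by exists [::], x, y, q.
Qed.

Section FromCut.
Variables (S : pred V) (a a' : V).
Hypothesis cutS : one_way_cut G S a a'.

(** A walk that starts after the cut is prolonged backwards to [a -> a'], one
    that ends before the cut is prolonged forwards. *)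
Lemma cut_extend p : is_path G p ->
  exists l r, is_path G (l ++ a :: a' :: r) /\ infix p (l ++ a :: a' :: r).
Proof.
case: p => // x q /is_path_cons[vx pq].
have [x1 [q1 [pq1 Sx1 inf1]]] : exists x1 q1,
    [/\ path e x1 q1, S x1 & exists t, x1 :: q1 = t ++ x :: q].
  have [Sx|nSx] := boolP (S x); first by exists x, q; split=> //; exists [::].
  have [r pr lr] := cut_from cutS vx nSx.
  exists a, (a' :: r ++ q); split; last 2 first.
  - exact: cut_src cutS.
  - exists (a :: belast a' r); rewrite -cat_rcons rcons_cons -lr -lastI //.
  by rewrite /= (cut_edge cutS) cat_path pr lr.
case: inf1 => t et.
have lastq : last x1 q1 = last x q.
  by have := congr1 (last x1) et; rewrite last_cat.
have vl : vert G (last x q).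
  case/lastP: {et lastq} q pq => // q z; rewrite rcons_path last_rcons.
  by case/andP=> _ /G_span[].
have [q2 [pq2 nS2]] : exists q2, path e x1 (q1 ++ q2) /\
    ~~ S (last x1 (q1 ++ q2)).
  have [Sl|nSl] := boolP (S (last x q)); last first.
    by exists [::]; rewrite cats0 lastq.
  have [r pr lr] := cut_to cutS vl Sl; exists (rcons r a').
  rewrite cat_path lastq rcons_path pr lr (cut_edge cutS) pq1.
  by rewrite last_cat last_rcons (cut_tgt cutS).
have [l [b [b' [r [E ebb Sb Sb']]]]] := path_crosses pq2 Sx1 nS2.
have [eb eb'] := cut_unique cutS ebb Sb Sb'; subst b b'.
exists l, r; split; first by rewrite is_path_through -E.
by rewrite -E -cat_cons et -catA infix_infix.
Qed.

(** On either side of the edge [a -> a'], the two prolonged walks do not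
    diverge, so the longer of the two contains the other. *)
Lemma cut_embedding : walk_embedding G.
Proof.
move=> p p' /cut_extend[l [r [w inf]]] /cut_extend[l' [r' [w' inf']]].
rewrite !is_path_through -!(cat_rcons a) in w w' inf inf' *.
have pathE l1 r1 : sorted e (rcons l1 a ++ a' :: r1) =
    path (fun u v => e v u) a (rev l1) && path e a' r1.
  rewrite -[path _ a _]/(sorted (fun u v => e v u) (a :: rev l1)).
  rewrite -rev_rcons rev_sorted.
  case: l1 => [|x l1] /=; first by rewrite (cut_edge cutS).
  by rewrite cat_path /= last_rcons (cut_edge cutS).
move: w w'; rewrite !pathE => /andP[pl pr] /andP[pl' pr'].
have [t Et] := @det_path_prefix _ e (predC S) a' r r'
  (fun u v nSu euv => contra (cut_closed cutS euv) nSu)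
  (fun u v w nSu euv euw => cut_outdeg cutS euv euw nSu) (cut_tgt cutS) pr pr'.
have [s Es] := @det_path_prefix _ (fun u v => e v u) S a (rev l) (rev l')
  (fun u v Su evu => cut_closed cutS evu Su)
  (fun u v w Su evu ewu => cut_indeg cutS evu ewu Su) (cut_src cutS) pl pl'.
have {}Es : l' = rev s ++ l \/ l = rev s ++ l'.
  by case: Es => /(congr1 rev); rewrite rev_cat !revK; [left|right].
have [r0 [pr0 [t1 e1] [t2 e2]]] : exists r0, [/\ path e a' r0,
    exists t1, r0 = r ++ t1 & exists t2, r0 = r' ++ t2].
  case: Et => Et; [exists r'|exists r]; split=> //.
  - by exists t.
  - by exists [::]; rewrite cats0.
  - by exists [::]; rewrite cats0.
  - by exists t.
have [l0 [pl0 [s1 f1] [s2 f2]]] :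
    exists l0, [/\ path (fun u v => e v u) a (rev l0),
      exists s1, l0 = s1 ++ l & exists s2, l0 = s2 ++ l'].
  case: Es => Es; [exists l'|exists l]; split=> //.
  - by exists (rev s).
  - by exists [::].
  - by exists [::].
  - by exists (rev s).
exists (rcons l0 a ++ a' :: r0); split.
- by rewrite cat_rcons is_path_through -cat_rcons pathE pl0.
- apply: infix_trans inf _.
  by rewrite f1 e1 rcons_cat -cat_cons -catA (catA (rcons l a)) infix_infix.
- apply: infix_trans inf' _.
  by rewrite f2 e2 rcons_cat -cat_cons -catA (catA (rcons l' a)) infix_infix.
Qed.

(** [rho_shape] for the part after the cut; the part before it is the same
    lemma in the converse digraph. *)
Lemma cut_rho (s : seq V) : (forall v, vert G v -> v \in s) ->
  exists q c,
    [/\ path e a' q /\ uniq (a' :: q),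
        [/\ cycle e c, uniq c & c != [::] -> last a' q \in c],
        forall v, v \in belast a' q -> v \notin c,
        forall v, (v \in vert G) && ~~ S v = (v \in (a' :: q) ++ c)
      & forall u v, (u \in vert G) && ~~ S u ->
          e u v = ((u, v) \in path_edges (a' :: q) ++ cycle_edges c)].
Proof.
move=> fin; apply: (@rho_shape _ e (fun v => (v \in vert G) && ~~ S v) s).
- by move=> v /andP[/set_mem /fin].
- rewrite (cut_tgt cutS) andbT; apply: mem_set.
  by have [] := G_span (cut_edge cutS).
- move=> u v /andP[_ nSu] euv; apply/andP; split.
    by apply: mem_set; have [] := G_span euv.
  by apply: contra nSu; apply: (cut_closed cutS).
- by move=> u v w /andP[_ nSu] euv euw; apply: (cut_outdeg cutS) euv euw nSu.
- by move=> v /andP[/set_mem vv nSv]; apply: (cut_from cutS).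
Qed.

End FromCut.

(** Degrees are controlled by comparing walks of equal length: if [w] in [S]
    had two predecessors, then following a walk from [w] through [a -> a'] would
    give two walks that cannot be aligned along [a -> a']. *)
Lemma embedding_cut : walk_embedding G -> ~ strongly_connected G ->
  exists S a a', one_way_cut G S a a'.
Proof.
move=> emb /existsNP[v0 /existsNP[u0 /not_implyP[vv0 /not_implyP[vu0 nvu]]]].
pose S : pred V := fun w => `[< reaches e w u0 >].
have Su0 : S u0 by apply/asboolP; exists [::].
have nSv0 : ~~ S v0.
  apply/asboolP=> -[q pq lq]; apply: nvu; exists q; split=> //.
  by apply/is_path_cons.
have closed u v : e u v -> S v -> S u.
  move=> euv /asboolP[q pq lq]; apply/asboolP; exists (v :: q) => //=.
  by rewrite euv.
have closedC u v : ~~ S u -> e u v -> ~~ S v.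
  by move=> nSu euv; apply: contra nSu; apply: closed.
have vwalk v : vert G v -> is_path G [:: v] by move=> vv; apply/is_path_cons.
have [a [a' [eaa Sa Sa']]] : exists a a', [/\ e a a', S a & ~~ S a'].
  have [r [wr]] := emb _ _ (vwalk _ vu0) (vwalk _ vv0).
  rewrite !infix1s => u0r v0r; case: r wr u0r v0r => // x q /is_path_cons[_ pq].
  move=> u0r v0r; have Sx : S x.
    apply: contraT => nSx; have /allP/(_ _ u0r) := path_closed closedC nSx pq.
    by rewrite /= Su0.
  have nSl : ~~ S (last x q).
    apply: contra nSv0 => Sl.
    have sq : sorted e (rcons (belast x q) (last x q)) by rewrite -lastI.
    move: v0r; rewrite lastI mem_rcons inE => /orP[/eqP-> //|].
    exact: (allP (sorted_before closed sq Sl)).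
  by have [l [b [b' [r []]]]] := path_crosses pq Sx nSl; exists b, b'.
have waa : is_path G [:: a; a'] by rewrite (@is_path_through [::]) /= eaa.
have uniqe u v : e u v -> S u -> ~~ S v -> u = a /\ v = a'.
  move=> euv Su nSv.
  have wuv : is_path G [:: u; v] by rewrite (@is_path_through [::]) /= euv.
  have [r [/is_path_sorted sr /infixP[l [r1 E1]] /infixP[l2 [r2 E2]]]] :=
    emb _ _ waa wuv.
  move: E2; rewrite E1 /= => E2; rewrite E1 /= in sr.
  by have [] := crossing_align closed sr Sa Sa' Su nSv E2.
(* Two walks through [a -> a'] agree as far as both extend. *)
have align l r l1 r1 : is_path G (l ++ a :: a' :: r) ->
    is_path G (l1 ++ a :: a' :: r1) ->
    exists g g' h h', g ++ l = g' ++ l1 /\ r ++ h = r1 ++ h'.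
  move=> w w1; have [t [/is_path_sorted st /infixP[g [h E1]]]] := emb _ _ w w1.
  case/infixP=> g' [h' E2]; exists g, g', h, h'.
  move: E2; rewrite E1 -!catA catA [in X in _ = X -> _]catA /= => E2.
  rewrite E1 -!catA catA /= in st.
  by have [] := crossing_align closed st Sa Sa' Sa Sa' E2.
have through v : vert G v -> exists l r,
    sorted e (l ++ a :: a' :: r) /\ v \in l ++ a :: a' :: r.
  move=> vv; have [t [/is_path_sorted st]] := emb _ _ (vwalk _ vv) waa.
  rewrite infix1s => vt /infixP[l [r E]]; exists l, r.
  by rewrite E in st vt.
have to v : vert G v -> S v -> reaches e v a.
  move=> vv Sv; have [l [r [sw vw]]] := through v vv.
  have vl : v \in rcons l a.
    move: vw sw; rewrite -cat_rcons mem_cat => /orP[//|vr] /cat_sorted2[_ pr].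
    by have /allP/(_ _ vr) := path_closed closedC Sa' pr; rewrite /= Sv.
  move: sw; rewrite -cat_rcons => /cat_sorted2[].
  have := last_rcons a l a; case/splitPr: vl => l1 l2; rewrite last_cat /= => H.
  by case/cat_sorted2=> _ /= pl _; exists l2.
have from v : vert G v -> ~~ S v -> reaches e a' v.
  move=> vv nSv; have [l [r [sw vw]]] := through v vv.
  move: sw vw; rewrite -cat_rcons => /cat_sorted2[sl sr].
  rewrite mem_cat mem_rcons inE -orbA => /or3P[/eqP E|vl|].
  - by rewrite E Sa in nSv.
  - by have /allP/(_ _ vl) := sorted_before closed sl Sa; rewrite (negbTE nSv).
  rewrite inE => /orP[/eqP->|]; first by exists [::].
  move=> vr; case/splitPr: vr sr => r1 r2 sr.
  exists (rcons r1 v); last by rewrite last_rcons.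
  by move: sr; rewrite /= -cat_rcons cat_path => /andP[].
exists S, a, a'; split=> //.
- move=> u v w euw evw Sw.
  have [q pq lq] := to w (G_span euw).2 Sw.
  have wk x : e x w -> is_path G ((x :: belast w q) ++ a :: a' :: [::]).
    move=> exw; rewrite is_path_through -cat_rcons rcons_cons -lq -lastI.
    by rewrite /= exw cat_path pq lq /= eaa.
  have [g [g' [h [h' [E _]]]]] := align _ _ _ _ (wk u euw) (wk v evw).
  have sg : size g = size g'.
    by move/(congr1 size): E; rewrite !size_cat /=; lia.
  by move/eqP: E; rewrite eqseq_cat // => /andP[_ /eqP[]].
- move=> u v w ewu ewv nSw.
  have [q pq lq] := from w (G_span ewu).1 nSw.
  have wk x : e w x -> is_path G ([::] ++ a :: a' :: rcons q x).
    by move=> ewx; rewrite is_path_through /= eaa rcons_path pq lq.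
  have [g [g' [h [h' [_ E]]]]] := align _ _ _ _ (wk u ewu) (wk v ewv).
  by move/eqP: E; rewrite -!cats1 -!catA eqseq_cat // => /andP[_ /eqP[]].
Qed.

End Cuts.

(** * Bicycles *)

Lemma simple_cycleP (V : eqType) (G : digraph V) (c : seq V) :
  spanning G -> c != [::] -> cycle (edge G) c -> uniq c -> simple_cycle G c.
Proof.
move=> G_span; case: c => // z c _ pc Uc; apply/andP; split=> //.
apply/is_path_cons => //; split=> //.
by case: c pc {Uc} => [|y c] /= /andP[/G_span[]].
Qed.

(** The backward rho shape of [a], reversed, and the forward rho shape of [a']
    are joined by the edge [a -> a']. *)
Lemma cut_bicycle (V : eqType) (G : digraph V) S a a' (s : seq V) :
  spanning G -> (forall v, vert G v -> v \in s) ->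
  one_way_cut G S a a' -> bicycle G.
Proof.
move=> G_span fin cutS.
have G_span' : spanning (converse G) by move=> u v /G_span[].
have [q2 [c2 [[p2 U2] [C2 Uc2 x2] d2 D2 E2]]] := cut_rho G_span cutS fin.
have [q1 [c1 [[p1 U1] [C1 Uc1 x1] d1 D1 E1]]] :=
  cut_rho G_span' (converse_cut cutS) fin.
have S1 v : v \in (a :: q1) ++ c1 -> S v by rewrite -D1 negbK => /andP[].
have S2 v : v \in (a' :: q2) ++ c2 -> ~~ S v by rewrite -D2 => /andP[].
have V1 v : v \in (a :: q1) ++ c1 -> v \in vert G by rewrite -D1 => /andP[].
have V2 v : v \in (a' :: q2) ++ c2 -> v \in vert G by rewrite -D2 => /andP[].
have eaa := cut_edge cutS.
pose x := last a q1; pose q := rev (belast a q1) ++ a' :: q2.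
have xqE : x :: q = rev (a :: q1) ++ a' :: q2.
  by rewrite [a :: q1]lastI rev_rcons.
have lq : last x q = last a' q2 by rewrite last_cat.
have Uxq : uniq (x :: q).
  rewrite xqE cat_uniq rev_uniq U1 U2 andbT; apply/hasPn=> v v2.
  rewrite mem_rev; apply/negP=> v1; have := S2 v; rewrite mem_cat v2 => /(_ isT).
  by rewrite S1 // mem_cat v1.
have pxq : path (edge G) x q.
  rewrite cat_path rev_path p1 /=.
  have -> : last x (rev (belast a q1)) = a.
    by rewrite /x; case: (q1) => [|z r] //=; rewrite rev_cons last_rcons.
  by rewrite eaa.
have inner v : v \in behead (belast x q) ->
    [/\ v \in x :: q, v != x & v != last x q].
  case: (q) Uxq => [|y r] //; rewrite cons_uniq => /andP[xr].
  rewrite {1}lastI rcons_uniq => /andP[lr _] /= vr.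
  have vyr : v \in y :: r by apply: mem_belast.
  rewrite in_cons vyr orbT; split=> //; first by apply: contraNneq xr => <-.
  by apply: contraNneq lr => <-.
exists (rev c1), c2, x, q; split.
- split.
  + move=> c1n; have {}c1n : c1 != [::].
      by apply: contraNneq c1n => ->.
    rewrite mem_rev (x1 c1n); split=> //; apply: simple_cycleP => //.
    * by rewrite -size_eq0 size_rev size_eq0.
    * by rewrite rev_cycle.
    * by rewrite rev_uniq.
  + by move=> c2n; rewrite lq (x2 c2n); split=> //; apply: simple_cycleP.
  + move=> v; rewrite mem_rev => v1; apply/negP=> v2.
    have := S2 v; rewrite mem_cat v2 orbT => /(_ isT).
    by rewrite S1 // mem_cat v1 orbT.
- split=> //.
  + by apply/is_path_cons => //; split=> //; apply/set_mem/V1; rewrite mem_cat mem_last.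
  + move=> v /inner[vq vx vl]; rewrite mem_cat mem_rev negb_or.
    move: vq; rewrite xqE mem_cat mem_rev => /orP[v1|v2].
      have vb : v \in belast a q1.
        by move: v1; rewrite lastI mem_rcons inE (negbTE vx).
      rewrite d1 //=; apply/negP=> vc2.
      have := S2 v; rewrite mem_cat vc2 orbT => /(_ isT).
      by rewrite S1 // mem_cat v1.
    have vb : v \in belast a' q2.
      by move: v2; rewrite lastI mem_rcons inE -lq (negbTE vl).
    rewrite d2 // andbT; apply/negP=> vc1.
    have := S2 v; rewrite mem_cat v2 => /(_ isT).
    by rewrite S1 // mem_cat vc1 orbT.
  + by rewrite /q size_cat /= addnS.
- move=> v; rewrite xqE; split=> [vv|].
    have [Sv|nSv] := boolP (S v).
      have : v \in (a :: q1) ++ c1 by rewrite -D1 mem_set //= Sv.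
      by rewrite !mem_cat !mem_rev => /orP[] ->; rewrite ?orbT.
    have : v \in (a' :: q2) ++ c2 by rewrite -D2 mem_set //= nSv.
    by rewrite !mem_cat => /orP[] ->; rewrite ?orbT.
  rewrite !mem_cat !mem_rev => /orP[/orP[]|/orP[]] H; apply/set_mem;
    by [apply: V1; rewrite mem_cat H ?orbT|apply: V2; rewrite mem_cat H ?orbT].
- have crossE u v : ((u, v) \in path_edges (x :: q) ++ cycle_edges (rev c1) ++ cycle_edges c2)
   = [|| (v, u) \in path_edges (a :: q1) ++ cycle_edges c1, (u, v) == (a, a')
     | (u, v) \in path_edges (a' :: q2) ++ cycle_edges c2].
    have -> : path_edges (x :: q) =
      path_edges (rev (a :: q1)) ++ (a, a') :: path_edges (a' :: q2).
      by rewrite xqE rev_cons cat_rcons path_edges_cat.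
    rewrite !mem_cat in_cons path_edges_rev.
    have -> : ((u, v) \in cycle_edges (rev c1)) = ((v, u) \in cycle_edges c1).
      by apply/idP/idP; rewrite cycle_edges_rev.
    by do !case: (_ \in _); rewrite ?orbT ?orbF.
  move=> u v; rewrite crossE; split.
    move=> euv; have [uv vv] := G_span _ _ euv.
    have [Su|nSu] := boolP (S u); last first.
      have := E2 u v; rewrite mem_set // nSu => /(_ isT) <-.
      by rewrite euv !orbT.
    have [Sv|nSv] := boolP (S v); last first.
      by have [-> ->] := cut_unique cutS euv Su nSv; rewrite eqxx orbT.
    have := E1 v u; rewrite mem_set //= Sv => /(_ isT) <-.
    by rewrite euv.
  case/or3P => [H|/eqP[-> ->] //|H].
    rewrite -[edge G u v]/(edge (converse G) v u) E1 //.
    rewrite D1; move: H; rewrite !mem_cat => /orP[/mem_path_edges[/mem_belast-> _] //|].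
    by rewrite cycle_edgesP // => -[-> _]; rewrite orbT.
  rewrite E2 //.
  rewrite D2; move: H; rewrite !mem_cat => /orP[/mem_path_edges[/mem_belast-> _] //|].
  by rewrite cycle_edgesP // => -[-> _]; rewrite orbT.
Qed.

Section Bicycle.
Variables (V : eqType) (G : digraph V).
Hypothesis G_span : spanning G.
Implicit Types (p q c : seq V) (u v x y z : V).
Notation e := (edge G).

Lemma reaches_trans u v w : reaches e u v -> reaches e v w -> reaches e u w.
Proof.
by move=> [p pp <-] [q pq <-]; exists (p ++ q); rewrite ?cat_path ?pp ?last_cat.
Qed.

Lemma path_reaches x q v : path e x q -> v \in x :: q ->
  reaches e x v /\ reaches e v (last x q).
Proof.
move=> pq vq; case/splitPl: vq pq => p1 p2 <-; rewrite cat_path last_cat.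
by case/andP=> pp1 pp2; split; [exists p1|exists p2].
Qed.

Lemma cycle_reaches c u v : cycle e c -> u \in c -> v \in c -> reaches e u v.
Proof.
move=> cc uc vc; have [i r E] := rot_to uc.
have vr : v \in u :: r by rewrite -E mem_rot.
have pr : path e u r.
  by move: cc; rewrite -(rot_cycle i) E /= rcons_path => /andP[].
by have [] := path_reaches pr vr.
Qed.

(** The part before the cut is the initial cycle together with the start [x]
    of the connecting path.  When a cycle is absent, the definition of a bicycle
    allows both ends of the connecting path to lie on the other cycle, or the
    path to be a single vertex.  In these cases the end of the path
    reaches its start and the digraph is strongly connected. *)
Lemma bicycle_cut : bicycle G -> ~ strongly_connected G ->
  exists S a a', one_way_cut G S a a'.
Proof.
case=> c1 [c2 [x [q [[H1 H2 d12] [/is_path_cons[//|_ pq] Uq inner _] vE eE]]]].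
have simpleP c : simple_cycle G c -> cycle e c /\ uniq c.
  by case: c => // z c /andP[/is_path_cons[]].
have nilP c v : v \in c -> c != [::] by case: c.
have cyc1 : cycle e c1.
  by have [->//|/H1[/simpleP[]]] := eqVneq c1 [::].
have U1 : uniq c1 by have [->//|/H1[/simpleP[]]] := eqVneq c1 [::].
have cyc2 : cycle e c2.
  by have [->//|/H2[/simpleP[]]] := eqVneq c2 [::].
have U2 : uniq c2 by have [->//|/H2[/simpleP[]]] := eqVneq c2 [::].
have x1 v : v \in c1 -> x \in c1 by move=> /nilP /H1[].
have z2 v : v \in c2 -> last x q \in c2 by move=> /nilP /H2[].
set z := last x q in H2 z2 *.
have xz : reaches e x z by exists q.
have ends v : vert G v -> reaches e x v /\ reaches e v z.
  rewrite vE !mem_cat => /or3P[|v1|v2]; first exact: path_reaches.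
    split; first exact: (cycle_reaches cyc1 (x1 _ v1) v1).
    exact: (reaches_trans (cycle_reaches cyc1 v1 (x1 _ v1))).
  split; last exact: (cycle_reaches cyc2 v2 (z2 _ v2)).
  exact: (reaches_trans xz (cycle_reaches cyc2 (z2 _ v2) v2)).
move=> nSC; have nzx : ~ reaches e z x.
  move=> zx; apply: nSC => u v uG vG.
  have [r pr <-] := reaches_trans (ends u uG).2 (reaches_trans zx (ends v vG).1).
  by exists r; split=> //; apply/is_path_cons.
have [y [q' Eq]] : exists y q', q = y :: q'.
  case: (q) @z nzx {H2 z2 xz ends} => [|y q'] z nzx; last by exists y, q'.
  by case: nzx; exists [::].
have Ez : z = last y q' by rewrite /z Eq.
subst q; move: Uq; rewrite cons_uniq => /andP[xq' Uq'].
pose S : pred V := fun v => (v == x) || (v \in c1).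
have nSq v : v \in y :: q' -> ~~ S v.
  move=> vq; rewrite negb_or; apply/andP; split.
    by apply: contraNneq xq' => <-.
  move: vq; rewrite lastI mem_rcons in_cons -Ez => /orP[/eqP->|vq].
    apply/negP=> z1; apply: nzx; exact: cycle_reaches cyc1 z1 (x1 _ z1).
  by have := inner v vq; rewrite mem_cat negb_or => /andP[].
have nSc v : v \in c2 -> ~~ S v.
  move=> v2; rewrite negb_or; apply/andP; split.
    apply/negP=> /eqP Ev; apply: nzx.
    by apply: cycle_reaches cyc2 (z2 _ v2) _; rewrite -Ev.
  by apply/negP=> /d12; rewrite v2.
have edgeP u v : e u v -> [\/ (u, v) = (x, y), (u, v) \in path_edges (y :: q'),
    (u, v) \in cycle_edges c1 | (u, v) \in cycle_edges c2].
  rewrite eE path_edges_cons cat_cons in_cons !mem_cat.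
  by case/or4P=> [/eqP||| ]; [constructor 1|constructor 2|constructor 3|constructor 4].
have in_edge u v : e u v -> S v -> (u, v) \in cycle_edges c1.
  case/edgeP=> [[_ ->]|/mem_path_edges[_ vq']|//|].
  - by rewrite (negbTE (nSq y _)) ?mem_head.
  - by rewrite (negbTE (nSq v _)) // in_cons vq' orbT.
  - by rewrite cycle_edgesP // => -[u2 ->]; rewrite (negbTE (nSc _ _)) // mem_next.
have out_edge u v : e u v -> ~~ S u ->
    (u, v) \in path_edges (y :: q') \/ (u, v) \in cycle_edges c2.
  case/edgeP=> [[-> _]|H|H|H]; [|by left| |by right].
  - by rewrite /S eqxx.
  - by move: H; rewrite cycle_edgesP // /S => -[-> _]; rewrite orbT.
have exy : e x y by rewrite eE path_edges_cons cat_cons mem_head.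
exists S, x, y; split=> //.
- by rewrite /S eqxx.
- by apply: nSq; rewrite mem_head.
- move=> u v euv Sv; have := in_edge u v euv Sv.
  by rewrite cycle_edgesP // /S => -[-> _]; rewrite orbT.
- move=> u v euv Su nSv; case/edgeP: euv => [[-> ->] //|H|H|H].
  + have [/mem_belast uq _] := mem_path_edges H.
    by have := nSq u uq; rewrite Su.
  + move: H nSv; rewrite cycle_edgesP // /S => -[u1 ->].
    by rewrite mem_next u1 orbT.
  + by move: H; rewrite cycle_edgesP // => -[/nSc]; rewrite Su.
- move=> u v w euw evw Sw; move: (in_edge u w euw Sw) (in_edge v w evw Sw).
  rewrite !cycle_edgesP // => -[_ ->] [_ Ew].
  by rewrite -[u](prev_next U1) Ew prev_next.
- have mixed w u v : (w, u) \in path_edges (y :: q') ->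
      (w, v) \in cycle_edges c2 -> u = v.
    case/mem_path_edges=> wq _; rewrite cycle_edgesP // => -[w2 _].
    by have := inner w wq; rewrite mem_cat w2 orbT.
  move=> u v w ewu ewv nSw.
  case: (out_edge w u ewu nSw) (out_edge w v ewv nSw) => H [] H'.
  + exact: path_edges_det Uq' H H'.
  + exact: mixed H H'.
  + by apply/esym; apply: mixed H' H.
  + by move: H H'; rewrite !cycle_edgesP // => -[_ ->] [_ ->].
- move=> v _ /orP[/eqP->|v1]; first by exists [::].
  exact: (cycle_reaches cyc1 v1 (x1 _ v1)).
- move=> v vG nSv; move: pq => /= /andP[_ pq'].
  have yz : reaches e y z by exists q'; rewrite ?Ez.
  move: vG; rewrite vE !mem_cat in_cons.
  case/or3P => [/orP[vx|]|v1|v2].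
  + by rewrite /S vx in nSv.
  + by move=> /(path_reaches pq')[].
  + by rewrite /S v1 orbT in nSv.
  + exact: reaches_trans yz (cycle_reaches cyc2 (z2 _ v2) v2).
Qed.

End Bicycle.

(** * Gluing structures in an avoidance class *)

Lemma max_len_bound sig (B : {fset structure sig}) t :
  t \in B -> len t <= max_len B.
Proof.
move=> tB; rewrite /max_len; case: eqP => [B0|_].
  by rewrite B0 in_fset0 in tB.
exact: (@leq_bigmax_seq _ _ _ (fun t => len t)).
Qed.

Lemma max_len_gt0 sig (B : {fset structure sig}) :
  (forall t, t \in B -> 1 <= len t) -> 1 <= max_len B.
Proof.
move=> B1; have [B0|[t tB]] := fset_0Vmem B; first by rewrite /max_len B0 eqxx.
exact: leq_trans (B1 t tB) (max_len_bound tB).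
Qed.

Section Windows.
Variables (sig : seq nat) (b : nat).
Implicit Types s t u : structure sig.
Notation windows s := (assoc_path b s).

Lemma windowsE s : windows s = [seq factor s i b | i <- iota 0 (len s - b + 1)].
Proof.
rewrite /assoc_path -[1]/(1 + 0) iotaDl -map_comp; apply: eq_map => i /=.
by rewrite /factor; congr restr; lia.
Qed.

Lemma size_windows s : size (windows s) = len s - b + 1.
Proof. by rewrite size_map size_iota. Qed.

Lemma windows_factor s o n : b <= n -> o + n <= len s ->
  windows (factor s o n) = take (n - b + 1) (drop o (windows s)).
Proof.
move=> bn le_n; rewrite !windowsE len_factor -map_drop -map_take.
rewrite drop_iota take_iota add0n.
have -> : minn (n - b + 1) (len s - b + 1 - o) = n - b + 1 by lia.
rewrite -[in RHS](addn0 o) iotaDl -map_comp.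
apply/eq_in_map => i; rewrite mem_iota => /andP[_ lt_i].
by rewrite factor_factor //; lia.
Qed.

Lemma windows_vert u : len u = b -> windows u = [:: u].
Proof.
by move=> lu; rewrite windowsE lu subnn /= -lu factor_full.
Qed.

Lemma last_windows u s : b <= len s ->
  last u (windows s) = factor s (len s - b) b.
Proof.
by move=> bs; rewrite windowsE addn1 -[(_ - _).+1]addn1 iotaD map_cat last_cat.
Qed.

Lemma windows_cons s : exists q, windows s = factor s 0 b :: q.
Proof. by rewrite windowsE addn1 /=; eexists. Qed.

Lemma cle_infix s t : b <= len s -> cle s t -> infix (windows s) (windows t).
Proof.
move=> bs /cleP[o le_o ->]; rewrite windows_factor //.
exact: infix_trans (infix_take _ _) (infix_drop _ _).
Qed.

End Windows.

Section AvoidanceClass.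
Variables (sig : seq nat) (X : set (structure sig)).
Variables (B : {fset structure sig}) (C : set (structure sig)) (b : nat).
Hypothesis (hX : structure_type X) (hC : C = avoid X B).
Implicit Types s t u v : structure sig.
Notation G := (factor_graph C b).
Notation windows s := (assoc_path b s).

Lemma C_down_closed : down_closed X C.
Proof.
rewrite hC; split=> [s []//|s t [Xt At] Xs st]; split=> // w wB ws.
by apply: (At w wB); apply: cle_trans ws st.
Qed.

Lemma C_len s : C s -> 1 <= len s.
Proof. by rewrite hC => -[/(proj1 hX)]. Qed.

Lemma C_factor s o n : C s -> 1 <= n -> o + n <= len s -> C (factor s o n).
Proof.
move=> Cs n1 le_n; have [CX dC] := C_down_closed.
apply: (dC _ _ Cs _ (cle_factor le_n)).
by apply: (proj2 hX s o.+1 (o + n) (CX _ Cs)) => //; lia.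
Qed.

Hypothesis (hvalid : valid X) (hB : forall t, t \in B -> X t).
Hypothesis (hb : b = max_len B) (hb1 : b = 1 -> combinable_on X 0).

Lemma b_gt0 : 0 < b.
Proof. by rewrite hb; apply: max_len_gt0 => t /hB /(proj1 hX). Qed.

(** An occurrence of a base element [w] that is not within the copy of [s]
    starts at least [len s - b + 1] points into the result, hence within the copy
    of [t], which starts [x >= b - 1] points before the end of [s].  Only for
    [b = 1] can the overlap be empty, whence the assumption on juxtaposition. *)
Lemma combine_in_C s t x : C s -> C t -> b - 1 <= x -> x <= len s ->
  x <= len t -> factor s (len s - x) x = factor t 0 x ->
  exists u, [/\ C u, len u = len s + len t - x, factor u 0 (len s) = s
              & factor u (len s - x) (len t) = t].
Proof.
move=> Cs Ct bx xs xt est; have [CX _] := C_down_closed.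
have ov : overlap x s t.
  split=> //; move: est; rewrite /factor add0n => <-.
  by rewrite addn1 subnK.
have [u [Xu [lu us ut]]] : exists u, X u /\ combines x s t u.
  have [x0|x0] := posnP x; last by apply: hvalid => //; apply: CX.
  subst x; apply: hb1; [have := b_gt0; lia|exact: CX|exact: CX|exact: ov].
have {}us : factor u 0 (len s) = s by rewrite /factor add0n.
have {}ut : factor u (len s - x) (len t) = t.
  by rewrite -[RHS]ut /factor; congr restr; lia.
exists u; split=> //; rewrite hC; split=> // w wB /cleP[o lw ew].
have lwb : len w <= b by rewrite hb; apply: max_len_bound.
have [ls|ls] := leqP (o + len w) (len s).
  move: Cs; rewrite hC => -[_ /(_ w wB)]; apply; apply/cleP; exists o => //.
  by rewrite -us factor_factor.
move: Ct; rewrite hC => -[_ /(_ w wB)]; apply; apply/cleP.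
exists (o - (len s - x)); first lia.
rewrite -ut factor_factor; last lia.
by rewrite [LHS]ew; congr factor; lia.
Qed.

Lemma G_spanning : spanning G.
Proof. by move=> u v /and3P[/set_mem ? /set_mem ? _]. Qed.

Lemma G_edgeP u v : edge G u v <->
  [/\ fg_vert C b u, fg_vert C b v & factor u 1 (b - 1) = factor v 0 (b - 1)].
Proof.
have e1 : restr u 2 b = factor u 1 (b - 1).
  by rewrite /factor; congr restr; have := b_gt0; lia.
split=> [/and3P[/set_mem uC /set_mem vC /eqP]|[uC vC E]]; first by rewrite e1.
by apply/and3P; split; [exact: mem_set|exact: mem_set|rewrite e1 E].
Qed.

Lemma windows_is_path s : C s -> b <= len s -> is_path G (windows s).
Proof.
move=> Cs bs; have b0 := b_gt0.
have vs i : i + b <= len s -> fg_vert C b (factor s i b).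
  by move=> le_i; split; rewrite ?len_factor //; apply: C_factor.
have -> : windows s =
    factor s 0 b :: [seq factor s i b | i <- iota 1 (len s - b)].
  by rewrite windowsE addn1.
apply/is_path_cons; first exact: G_spanning.
split; first exact: vs.
have: 0 + (len s - b) + b <= len s by lia.
elim: (len s - b) 0 => //= n IH i le_i.
rewrite IH ?andbT; last lia.
apply/G_edgeP; split; try by (apply: vs; lia).
by rewrite !factor_factor; try lia; congr factor; lia.
Qed.

(** Overlapping two members of [C] on a full window joins their associated
    paths at a common vertex, and both remain factors of the result. *)
Lemma glue s t l m r : C s -> C t -> b <= len s -> b <= len t ->
  windows s = rcons l m -> windows t = m :: r ->
  exists u, [/\ C u, len u = size l + len t, windows u = l ++ windows t,
    factor u 0 (len s) = s & factor u (size l) (len t) = t].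
Proof.
move=> Cs Ct bs bt Es Et.
have sl : size l = len s - b.
  by have := congr1 size Es; rewrite size_windows size_rcons; lia.
have ms : factor s (len s - b) b = m.
  by rewrite -(last_windows m bs) Es last_rcons.
have mt : factor t 0 b = m.
  by have [q] := windows_cons b t; rewrite Et => -[].
have [||||u [Cu lu us ut]] := @combine_in_C s t b Cs Ct; rewrite ?ms ?mt ?leq_subr //.
exists u; split=> //; [lia| |by rewrite sl].
have e1 := @windows_factor _ b u 0 (len s) bs; rewrite us drop0 in e1.
have e2 := @windows_factor _ b u (size l) (len t) bt; rewrite sl ut in e2.
rewrite -[LHS](cat_take_drop (len s - b)) e2; last lia.
congr (_ ++ _); last first.
  by rewrite take_oversize // size_drop size_windows; lia.
have := congr1 (take (len s - b)) (e1 _); rewrite take_takel; last lia.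
by move=> <-; [rewrite Es -cats1 take_cat -sl ltnn subnn cats0|lia].
Qed.

(** An edge of the factor graph is an overlap on [b - 1] points, so each step
    of the walk adds one point. *)
Lemma extend_right q s : C s -> b <= len s ->
  path (edge G) (factor s (len s - b) b) q ->
  exists t, [/\ C t, len t = len s + size q, windows t = windows s ++ q
              & factor t 0 (len s) = s].
Proof.
have b0 := b_gt0.
elim: q s => [|v q IH] s Cs bs.
  by move=> _; exists s; rewrite addn0 cats0 factor_full.
rewrite [path _ _ _]/= => /andP[/G_edgeP[_ [Cv lv] E] pq].
rewrite factor_factor in E; last lia.
have [| | |u [Cu lu us uv]] := @combine_in_C s v (b - 1) Cs Cv (leqnn _); try lia.
  by rewrite -E; congr factor; lia.
have {}lu : len u = (len s).+1 by lia.
have bu : b <= len u by lia.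
have eu : factor u (len u - b) b = v.
  by rewrite -[RHS]uv lv; congr factor; lia.
have wu : windows u = rcons (windows s) v.
  have lw := @last_windows _ b v u; rewrite eu in lw.
  have := @windows_factor _ b u 0 (len s) bs; rewrite us drop0 => -> ; last lia.
  have [r Er] : exists r, windows u = rcons r v.
    case/lastP: (windows u) lw (size_windows b u) => [_|r w].
      by rewrite /=; lia.
    by rewrite last_rcons => <- // _; exists r.
  have := size_windows b u; rewrite Er size_rcons => sr.
  by rewrite -cats1 takel_cat ?take_oversize ?cats1 //; lia.
have [|t [Ct lt wt tu]] := IH u Cu bu; first by rewrite eu.
exists t; split=> //; first by rewrite lt /=; lia.
  by rewrite wt wu cat_rcons.
by rewrite -[RHS]us -tu factor_factor //; lia.
Qed.

(** On the left, the walk [l] is first realized by a structure of its own, which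
    is then glued to the structure at hand: thus [s] itself is kept, and not
    merely some structure with the same path. *)
Lemma extend l s r : C s -> b <= len s -> is_path G (l ++ windows s ++ r) ->
  exists t, [/\ C t, windows t = l ++ windows s ++ r, size l + len s <= len t
              & factor t (size l) (len s) = s].
Proof.
move=> Cs bs w; have [q Eq] := windows_cons b s.
have lq : last (factor s 0 b) q = factor s (len s - b) b.
  by have := last_windows (factor s 0 b) bs; rewrite Eq.
have pr : path (edge G) (factor s (len s - b) b) r.
  move: w => /is_path_sorted -/(_ G_spanning) /cat_sorted2[_].
  by rewrite Eq /= cat_path lq => /andP[].
have [t [Ct lt wt ts]] := extend_right Cs bs pr.
case: l w => [|x l] w; first by exists t; split=> //; rewrite lt leq_addr.
have [vx px] : fg_vert C b x /\
    path (edge G) x (rcons l (factor s 0 b)).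
  move: w; rewrite cat_cons => /is_path_cons -/(_ G_spanning) [vx].
  by rewrite Eq -cat_rcons cat_path => /andP[].
have [Cx lx] := vx; have bx : b <= len x by rewrite lx.
have [|a [Ca la wa _]] := @extend_right (rcons l (factor s 0 b)) x Cx bx.
  by rewrite lx subnn -{2}lx factor_full.
have [||||u [Cu lu wu _ ut]] := @glue a t (x :: l) (factor s 0 b) (q ++ r) Ca Ct.
- lia.
- lia.
- by rewrite wa windows_vert.
- by rewrite wt Eq.
exists u; split=> //; first by rewrite wu wt.
  by rewrite lu lt; lia.
by rewrite -[RHS]ts -[t in RHS]ut factor_factor ?addn0 //; lia.
Qed.

Lemma is_path_realized p : is_path G p ->
  exists t, [/\ C t, b <= len t & windows t = p].
Proof.
case: p => // x q w; have [vx px] := (is_path_cons G_spanning x q).1 w.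
have [Cx lx] := vx; have bx : b <= len x by rewrite lx.
have [|t [Ct lt wt _]] := @extend_right q x Cx bx.
  by rewrite lx subnn -{2}lx factor_full.
by exists t; rewrite wt windows_vert //; split=> //; lia.
Qed.

Lemma joint_embedding_walks : joint_embedding C -> walk_embedding G.
Proof.
move=> JE p q /is_path_realized[s [Cs bs <-]] /is_path_realized[t [Ct bt <-]].
have [u [Cu su tu]] := JE s t Cs Ct; exists (windows u); split.
- by apply: windows_is_path => //; apply: leq_trans (cle_len su).
- exact: cle_infix.
- exact: cle_infix.
Qed.

(** Two structures [s], [t] with the same path are extended along a common
    walk through [a -> a'].  The extensions [s'] and [t'] lie in some [u], whose
    path crosses the cut only once, so they sit at the same offset [i = j]. *)
Lemma cut_unambiguous S a a' p : joint_embedding C -> one_way_cut G S a a' ->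
  is_path G p -> ~ ambiguous C b p.
Proof.
move=> JE cutS wp [s [t [[Cs bs Es] [Ct bt Et] nst]]]; apply: nst.
have [l [r [w /infixP[g [h E]]]]] := cut_extend G_spanning cutS wp.
have ws : is_path G (g ++ windows s ++ h) by rewrite Es -E.
have wt : is_path G (g ++ windows t ++ h) by rewrite Et -E.
have [s' [Cs' Ws' ls' es]] := extend Cs bs ws.
have [t' [Ct' Wt' lt' et]] := extend Ct bt wt.
have lst : len s = len t.
  by have := congr1 size Es; rewrite -Et !size_windows; lia.
suff st' : s' = t' by rewrite -es -et st' lst.
rewrite Es -E in Ws'; rewrite Et -E in Wt'.
have ll' : len s' = len t'.
  by have := congr1 size Ws'; rewrite -Wt' !size_windows; lia.
have [u [Cu /cleP[i li ei] /cleP[j lj ej]]] := JE s' t' Cs' Ct'.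
have bu : b <= len u by lia.
have su := is_path_sorted G_spanning (windows_is_path Cu bu).
have split_at o n : b <= n -> o + n <= len u ->
    exists x y, size x = o /\ windows u = x ++ windows (factor u o n) ++ y.
  move=> bn le_n; exists (take o (windows u)).
  exists (drop (n - b + 1) (drop o (windows u))); split.
    by rewrite size_takel // size_windows; lia.
  by rewrite windows_factor // cat_take_drop cat_take_drop.
have [||x [y [sx Ex]]] := split_at i (len s'); try lia.
have [||x' [y' [sx' Ex']]] := split_at j (len t'); try lia.
rewrite -ei Ws' in Ex; rewrite -ej Wt' in Ex'.
rewrite -!catA catA !cat_cons in Ex; rewrite -!catA catA !cat_cons in Ex'.
have := Ex'; rewrite {1}Ex => E'; rewrite Ex in su.
have [El _ _ _] := crossing_align (cut_closed cutS) su (cut_src cutS)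
  (cut_tgt cutS) (cut_src cutS) (cut_tgt cutS) E'.
have ij : i = j.
  by have := congr1 size El; rewrite !size_cat sx sx'; lia.
by rewrite ei ej ij ll'.
Qed.

End AvoidanceClass.

Theorem theorem8p1 (sig : seq nat) (X : set (structure sig))
    (B : {fset structure sig}) (C : set (structure sig)) (b : nat)
    (hX : structure_type X) (hvalid : valid X)
    (hB : forall t, t \in B -> X t)
    (hC : C = avoid X B) (hinf : infinite_set C)
    (hb : b = max_len B)
    (hb1 : b = 1 -> combinable_on X 0) :
  atomic X C <->
  (strongly_connected (factor_graph C b) \/
   (bicycle (factor_graph C b) /\
    forall p : seq (structure sig),
      is_path (factor_graph C b) p -> ~ ambiguous C b p)) /\
  (forall s : structure sig, C s -> 1 <= len s <= b - 1 ->
     exists t : structure sig, [/\ C t, len t = b & cle s t]).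
Proof.
rewrite (atomicP (C_down_closed hC)).
have span := @G_spanning sig C b.
have b0 := b_gt0 hX hB hb.
split=> [JE|[graph up]].
  split; last first.
    move=> s Cs /andP[_ sb]; have [t Ct bt] := infinite_long b hinf.
    have [u [Cu /cleP[o lo Es] tu]] := JE s t Cs Ct.
    have bu := leq_trans bt (cle_len tu).
    (* The window of length [b] must not exceed [u], so it starts at the copy of
       [s] or earlier. *)
    pose o' := minn o (len u - b).
    exists (factor u o' b); split; last 1 first.
    - apply/cleP; exists (o - o'); rewrite ?len_factor; first lia.
      by rewrite factor_factor; [rewrite [LHS]Es; congr factor; lia|lia].
    - by apply: (C_factor hX hC) => //; lia.
    - exact: len_factor.
  have [|nSC] := pselect (strongly_connected (factor_graph C b)); first by left.
  right; have emb := joint_embedding_walks hX hC hvalid hB hb hb1 JE.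
  have [S [a [a' cutS]]] := embedding_cut span emb nSC.
  split; last by move=> p; apply: (cut_unambiguous hX hC hvalid hB hb hb1 JE cutS).
  apply: (@cut_bicycle _ _ S a a' (structures_of_len sig b)) => // v [_ lv].
  by have := structures_of_lenP v; rewrite lv.
have extend_up s : C s -> exists t, [/\ C t, b <= len t & cle s t].
  move=> Cs; have [bs|sb] := leqP b (len s).
    by exists s; split=> //; apply: cle_refl.
  have [|t [Ct lt st]] := up s Cs; first by have := C_len hX hC Cs; lia.
  by exists t; rewrite lt.
suff JE s t : C s -> C t -> b <= len s -> b <= len t ->
    exists u, [/\ C u, cle s u & cle t u].
  move=> s t /extend_up[s' [Cs' bs' ss']] /extend_up[t' [Ct' bt' tt']].
  have [u [Cu su tu]] := JE s' t' Cs' Ct' bs' bt'.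
  by exists u; split=> //; [apply: cle_trans su|apply: cle_trans tu].
move=> Cs Ct bs bt.
have [SC|nSC] := pselect (strongly_connected (factor_graph C b)).
  have vert_factor w o : C w -> o + b <= len w -> fg_vert C b (factor w o b).
    by move=> Cw lo; split; rewrite ?len_factor //; apply: (C_factor hX hC).
  have [||q [/is_path_cons -/(_ span) [_ pq] lq]] :=
    SC (factor s (len s - b) b) (factor t 0 b).
  - by apply: vert_factor => //; lia.
  - by apply: vert_factor => //; lia.
  have [s' [Cs' ls' ws' es']] := extend_right hX hC hvalid hB hb hb1 Cs bs pq.
  have [q0 Eq0] := windows_cons b s; have [r Er] := windows_cons b t.
  have El : assoc_path b s' = rcons (belast (factor s 0 b) (q0 ++ q)) (factor t 0 b).
    rewrite ws' Eq0 cat_cons lastI last_cat; congr rcons.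
    by rewrite -lq -(last_windows (factor s 0 b) bs) Eq0.
  have [|u [Cu lu _ us ut]] :=
    glue hX hC hvalid hB hb hb1 Cs' Ct _ bt El Er; first lia.
  have sl := congr1 size El; rewrite size_windows size_rcons in sl.
  exists u; split=> //.
  - apply: (@cle_trans _ _ s'); first by apply: (factor_cle es'); lia.
    by apply: (factor_cle us); lia.
  - by apply: (factor_cle ut); lia.
case: graph => [//|[bic unamb]].
have [S [a [a' cutS]]] := bicycle_cut span bic nSC.
have wpath w : C w -> b <= len w -> is_path (factor_graph C b) (assoc_path b w).
  exact: (windows_is_path hX hC hB hb hb1).
have [r [wr infs inft]] :=
  cut_embedding span cutS (wpath s Cs bs) (wpath t Ct bt).
have [u [Cu bu Eu]] := is_path_realized hX hC hvalid hB hb hb1 wr.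
suff inf_cle w : C w -> b <= len w -> infix (assoc_path b w) r -> cle w u.
  by exists u; split=> //; apply: inf_cle.
move=> Cw bw /infixP[g [h Er]].
have lw : size g + len w <= len u.
  by have := congr1 size Er; rewrite -Eu !size_cat !size_windows; lia.
apply: (@factor_cle _ _ _ (size g)) => //.
apply: contrapT => nuw; apply: (unamb _ (wpath w Cw bw)).
exists (factor u (size g) (len w)), w; split=> //; split=> //.
- by apply: (C_factor hX hC) => //; lia.
- by rewrite len_factor.
- rewrite windows_factor // Eu Er drop_size_cat //.
  by rewrite take_size_cat // size_windows.
Qed.
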